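(* Let $\alpha,\beta,\gamma,\mu,\nu,\kappa,D$ be real constants with $\nu\neq0$, $\alpha=4\nu$, $\beta=3\nu$, $\gamma=0$ and $\kappa=D^2$. Let $I\subset\mathbb{R}$ be an open interval and $H\in C^4(I)$ a real-valued function. Then $u(x,t)=H(x-Dt)$ is a solution, on the set $\{(x,t)\in\mathbb{R}^2: x-Dt\in I\}$, of $$u_{tt}=(\kappa u+\gamma u^2)_{xx}+\nu u u_{xxxx}+\mu u_{xxtt}+\alpha u_xu_{xxx}+\beta u_{xx}^2$$ if and only if there are real constants $C_0,C_1,C_2,C_3$ such that on this set $$\frac{u(x,t)^2}{2}+\frac{D^2\mu}{\nu}\,u(x,t)=C_0+C_1(x-Dt)+C_2(x-Dt)^2+C_3(x-Dt)^3 .$$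
   Context: Subscripts denote partial derivatives of $u=u(x,t)$. Solutions of the form $u(x,t)=H(x-Dt)$ are travelling wave solutions with constant phase velocity $D$. For $u(x,t)=H(x-Dt)$ the partial derivatives are understood through $H$: $u_x=H'$, $u_{tt}=D^2H''$, $u_{xxtt}=D^2H^{(4)}$, etc., evaluated at $x-Dt$. *)

(* Defs.v *)
(* Real analysis over Stdlib's R with Coquelicot. *)
From Stdlib Require Import Reals.
From Coquelicot Require Import Coquelicot.
Open Scope R_scope.

(* The endpoints range over the extended reals, so bounded intervals,
   half-lines and the whole line are all covered. *)
Definition Rbar_open_interval (a b : Rbar) (s : R) : Prop :=
  Rbar_lt a s /\ Rbar_lt s b.

(* H is a total function, but for an open set I only its values on I matter.
   Derive_n is total as well, hence the explicit existence clause; continuity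
   of the derivatives of order < n follows from differentiability. *)
Definition C_n (n : nat) (I : R -> Prop) (H : R -> R) : Prop :=
  forall s, I s ->
    (forall k, (k <= n)%nat -> ex_derive_n H k s) /\
    continuous (Derive_n H n) s.

Definition travelling_wave (H : R -> R) (D : R) : R -> R -> R :=
  fun x t => H (x - D * t).

(* [partial_derive m k u x t] differentiates k times in t, then m times in x.
   It is a total operator: the definition is meant for u whose derivatives of
   order <= 4 exist and are continuous on the open set S, for which the order
   of differentiation in u_xxtt is immaterial. *)
Definition is_solution (kappa gamma nu mu alpha beta : R)
    (S : R -> R -> Prop) (u : R -> R -> R) : Prop :=
  forall x t, S x t ->
    partial_derive 0 2 u x t =
      partial_derive 2 0 (fun y s => kappa * u y s + gamma * u y s ^ 2) x t
      + nu * u x t * partial_derive 4 0 u x t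
      + mu * partial_derive 2 2 u x t
      + alpha * partial_derive 1 0 u x t * partial_derive 3 0 u x t
      + beta * partial_derive 2 0 u x t ^ 2.

(* Main.v *)
Require Import Defs.
From Stdlib Require Import Reals Lra Lia Classical.
From Coquelicot Require Import Coquelicot.
Open Scope R_scope.

(** Put [c = D^2 mu / nu] and [G = H^2/2 + c H].  For a travelling wave with
    [kappa = D^2] the terms [u_tt] and [kappa u_xx] cancel, and with
    [alpha = 4 nu], [beta = 3 nu] what remains is exactly [nu G'''' = 0].  On an
    interval this says that [G] is a cubic polynomial. *)

Lemma open_Rbar_open_interval (a b : Rbar) : open (Rbar_open_interval a b).
Proof. apply open_and; [apply open_Rbar_gt | apply open_Rbar_lt]. Qed.

Lemma Rbar_open_interval_convex (a b : Rbar) (x y t : R) :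
  Rbar_open_interval a b x -> Rbar_open_interval a b y -> x <= t <= y ->
  Rbar_open_interval a b t.
Proof.
intros [Hax _] [_ Hyb] [Hxt Hty]; split.
- now apply Rbar_lt_le_trans with x.
- now apply Rbar_le_lt_trans with y.
Qed.

(** [f - g] has zero derivative between any two points of the interval, so it is constant there.
    Stated as an equivalence, the lemma serves both to integrate and to differentiate an
    identity. *)
Lemma derivatives_eq_iff (a b : Rbar) (f g f' g' : R -> R) :
  (forall s, Rbar_open_interval a b s -> is_derive f s (f' s)) ->
  (forall s, Rbar_open_interval a b s -> is_derive g s (g' s)) ->
  (forall s, Rbar_open_interval a b s -> f' s = g' s) <->
  (exists C, forall s, Rbar_open_interval a b s -> f s = C + g s).
Proof.
intros Hf Hg; split.
- intros E.
  assert (Hmono : forall x y, Rbar_open_interval a b x ->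
    Rbar_open_interval a b y -> x < y -> f x - g x = f y - g y).
  { intros x y Hx Hy Hxy.
    apply (eq_is_derive (fun t => f t - g t) x y); [intros t Ht | exact Hxy].
    assert (It := Rbar_open_interval_convex a b x y t Hx Hy Ht).
    replace (@zero R_NormedModule) with (minus (f' t) (g' t)).
    - exact (is_derive_minus f g t _ _ (Hf t It) (Hg t It)).
    - rewrite (E t It); exact (minus_eq_zero (g' t)). }
  (* Nothing forces [a < b]. On an empty interval there is no base point and any constant will
     do. *)
  destruct (classic (exists s0, Rbar_open_interval a b s0)) as [[s0 H0]|Hempty].
  + exists (f s0 - g s0); intros s Hs.
    destruct (Rtotal_order s s0) as [Hlt|[->|Hgt]].
    * specialize (Hmono s s0 Hs H0 Hlt); lra.
    * lra.
    * specialize (Hmono s0 s H0 Hs Hgt); lra.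
  + exists 0; intros s Hs; destruct Hempty; now exists s.
- intros [C E] s Hs.
  rewrite <- (is_derive_unique _ _ _ (Hf s Hs)).
  rewrite <- (is_derive_unique _ _ _ (Hg s Hs)).
  rewrite (Derive_ext_loc f (fun y => C + g y)).
  + rewrite Derive_plus.
    * rewrite Derive_const; ring.
    * apply ex_derive_const.
    * exists (g' s); now apply Hg.
  (* The identity holds only on the interval; openness turns it into one valid near [s], which is
     what determines the derivative. *)
  + now apply (filter_imp (Rbar_open_interval a b));
      [|apply open_Rbar_open_interval].
Qed.

(** Four integrations in one direction, each adding a constant, and four differentiations in the
    other. *)
Lemma fourth_derivative_zero_iff (a b : Rbar) (G G1 G2 G3 G4 : R -> R) :
  (forall s, Rbar_open_interval a b s -> is_derive G s (G1 s)) ->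
  (forall s, Rbar_open_interval a b s -> is_derive G1 s (G2 s)) ->
  (forall s, Rbar_open_interval a b s -> is_derive G2 s (G3 s)) ->
  (forall s, Rbar_open_interval a b s -> is_derive G3 s (G4 s)) ->
  (forall s, Rbar_open_interval a b s -> G4 s = 0) <->
  (exists C0 C1 C2 C3, forall s, Rbar_open_interval a b s ->
    G s = C0 + C1 * s + C2 * s ^ 2 + C3 * s ^ 3).
Proof.
intros D0 D1 D2 D3; split.
- intros E.
  (* Each integrand is written in the shape left by the previous integration, hence the unsimplified
     [c3 + 0] in the next one. *)
  destruct (proj1 (derivatives_eq_iff a b G3 (fun _ => 0) G4 (fun _ => 0) D3
    ltac:(intros; auto_derive; trivial; ring)) E) as [c3 E3].
  destruct (proj1 (derivatives_eq_iff a b G2 (fun s => c3 * s) G3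
    (fun _ => c3 + 0) D2 ltac:(intros; auto_derive; trivial; ring)) E3)
    as [c2 E2].
  destruct (proj1 (derivatives_eq_iff a b G1 (fun s => c2 * s + c3 * s ^ 2 / 2)
    G2 (fun s => c2 + c3 * s) D1
    ltac:(intros; auto_derive; trivial; field)) E2) as [c1 E1].
  destruct (proj1 (derivatives_eq_iff a b G
    (fun s => c1 * s + c2 * s ^ 2 / 2 + c3 * s ^ 3 / 6)
    G1 (fun s => c1 + (c2 * s + c3 * s ^ 2 / 2)) D0
    ltac:(intros; auto_derive; trivial; field)) E1) as [c0 E0].
  exists c0, c1, (c2 / 2), (c3 / 6); intros s Hs; rewrite (E0 s Hs); field.
- intros (C0 & C1 & C2 & C3 & E).
  assert (E1 : forall s, Rbar_open_interval a b s ->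
    G1 s = C1 + 2 * C2 * s + 3 * C3 * s ^ 2).
  (* The polynomial is given without its constant term, which becomes the constant [C] of the
     equivalence; likewise below. *)
  { apply (derivatives_eq_iff a b G
      (fun s => C1 * s + C2 * s ^ 2 + C3 * s ^ 3) G1 _ D0).
    - intros; auto_derive; trivial; ring.
    - exists C0; intros s Hs; rewrite (E s Hs); ring. }
  assert (E2 : forall s, Rbar_open_interval a b s ->
    G2 s = 2 * C2 + 6 * C3 * s).
  { apply (derivatives_eq_iff a b G1
      (fun s => 2 * C2 * s + 3 * C3 * s ^ 2) G2 _ D1).
    - intros; auto_derive; trivial; ring.
    - exists C1; intros s Hs; rewrite (E1 s Hs); ring. }
  assert (E3 : forall s, Rbar_open_interval a b s -> G3 s = 6 * C3).
  { apply (derivatives_eq_iff a b G2 (fun s => 6 * C3 * s) G3 _ D2).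
    - intros; auto_derive; trivial; ring.
    - exists (2 * C2); intros s Hs; now rewrite (E2 s Hs). }
  apply (derivatives_eq_iff a b G3 (fun _ => 0) G4 _ D3).
  + intros; auto_derive; trivial; ring.
  + exists (6 * C3); intros s Hs; rewrite (E3 s Hs); ring.
Qed.

Lemma C_n_is_derive (n k : nat) (I : R -> Prop) (H : R -> R) (s : R) :
  C_n n I H -> (k < n)%nat -> I s ->
  is_derive (Derive_n H k) s (Derive_n H (S k) s).
Proof.
intros HC Hk Hs; apply Derive_correct.
exact (proj1 (HC s Hs) (S k) Hk).
Qed.

(** In the time variable the wave is a translate of [H] composed with scaling by [- D], and each
    derivative brings out one factor [- D]. The scaling rule needs differentiability near the point,
    obtained by pulling the open set [I] back along the translation. *)
Lemma Derive_n_travelling_wave_t (n k : nat) (I : R -> Prop) (H : R -> R)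
  (D x t : R) :
  open I -> C_n n I H -> (k <= n)%nat -> I (x - D * t) ->
  Derive_n (fun s => travelling_wave H D x s) k t =
    (- D) ^ k * Derive_n H k (x - D * t).
Proof.
intros HI HC Hk Hs; unfold travelling_wave.
rewrite (Derive_n_ext _ (fun s => (fun z => H (z + x)) (- D * s))).
2: { intros s; f_equal; ring. }
rewrite (Derive_n_comp_scal (fun z => H (z + x))).
- rewrite Derive_n_comp_trans; do 2 f_equal; ring.
- assert (Hloc : locally (- D * t) (fun z => I (z + x))).
  { apply (continuous_plus (fun z : R => z) (fun _ => x)).
    - apply continuous_id.
    - apply continuous_const.
    - apply HI; unfold plus; simpl.
      now replace (- D * t + x) with (x - D * t) by ring. }
  revert Hloc; apply filter_imp; intros z Hz j Hj.
  apply ex_derive_n_comp_trans, (HC _ Hz); lia.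
Qed.

Lemma partial_derive_travelling_wave (n m k : nat) (I : R -> Prop)
  (H : R -> R) (D x t : R) :
  open I -> C_n n I H -> (m + k <= n)%nat -> I (x - D * t) ->
  partial_derive m k (travelling_wave H D) x t =
    (- D) ^ k * Derive_n H (m + k) (x - D * t).
Proof.
intros HI HC Hmk Hs; unfold partial_derive.
(* The formula for the time derivative is known only where [y - D * t] lies in [I], so it is
   substituted locally around [x]. *)
rewrite (Derive_n_ext_loc _
  (fun y => (- D) ^ k * (fun z => Derive_n H k (z + - (D * t))) y)).
- rewrite Derive_n_scal_l, (Derive_n_comp_trans (Derive_n H k)).
  now rewrite Derive_n_comp.
- assert (Hloc : locally x (fun y => I (y - D * t))).
  { apply (continuous_minus (fun y : R => y) (fun _ => D * t)).
    - apply continuous_id.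
    - apply continuous_const.
    - now apply HI. }
  revert Hloc; apply filter_imp; intros y Hy.
  apply (Derive_n_travelling_wave_t n k I); trivial; lia.
Qed.

Theorem mainTheorem4 (alpha beta gamma mu nu kappa D : R)
  (Hnu : nu <> 0) (Halpha : alpha = 4 * nu) (Hbeta : beta = 3 * nu)
  (Hgamma : gamma = 0) (Hkappa : kappa = D ^ 2)
  (a b : Rbar) (H : R -> R) (HC4 : C_n 4 (Rbar_open_interval a b) H) :
  let u := travelling_wave H D in
  let S := fun x t => Rbar_open_interval a b (x - D * t) in
  is_solution kappa gamma nu mu alpha beta S u <->
  exists C0 C1 C2 C3 : R,
    forall x t, S x t ->
      u x t ^ 2 / 2 + D ^ 2 * mu / nu * u x t =
        C0 + C1 * (x - D * t) + C2 * (x - D * t) ^ 2 + C3 * (x - D * t) ^ 3.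
Proof.
intros u S; subst alpha beta gamma kappa.
set (c := D ^ 2 * mu / nu).
set (I := Rbar_open_interval a b) in *.
set (h := Derive_n H).
(* Successive derivatives of [G] by the Leibniz rule, with the linear term of [G] absorbed into the
   factor [H s + c]. *)
set (G1 := fun s => (H s + c) * h 1%nat s).
set (G2 := fun s => h 1%nat s ^ 2 + (H s + c) * h 2%nat s).
set (G3 := fun s => 3 * h 1%nat s * h 2%nat s + (H s + c) * h 3%nat s).
set (G4 := fun s => 3 * h 2%nat s ^ 2 + 4 * h 1%nat s * h 3%nat s
                    + (H s + c) * h 4%nat s).
assert (Hh : forall k s, (k < 4)%nat -> I s ->
  is_derive (h k) s (h (Datatypes.S k) s)).
{ intros k s Hk Hs; now apply (C_n_is_derive 4 k I). }
(* The same facts, eta-expanded to match the side conditions and derivatives produced by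
   [auto_derive]. *)
assert (Hx : forall k s, (k < 4)%nat -> I s ->
  ex_derive (fun y => h k y) s /\ Derive (fun y => h k y) s = h (Datatypes.S k) s).
{ intros k s Hk Hs; assert (Hd := Hh k s Hk Hs); split.
  - now exists (h (Datatypes.S k) s).
  - now apply is_derive_unique. }
assert (Hpde : is_solution (D ^ 2) 0 nu mu (4 * nu) (3 * nu) S u <->
               forall s, I s -> G4 s = 0).
{ assert (Hp : forall m k x t, (m + k <= 4)%nat -> I (x - D * t) ->
    partial_derive m k u x t = (- D) ^ k * h (m + k)%nat (x - D * t)).
  { intros m k x t Hmk Hs.
    apply (partial_derive_travelling_wave 4 m k I); trivial.
    apply open_Rbar_open_interval. }
  (* With [gamma = 0] the flux is a scalar multiple of [u], and scalars leave [Derive_n]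
     unconditionally, so no restriction to [S] is needed. *)
  assert (Hlin : forall x t,
    partial_derive 2 0 (fun y s => D ^ 2 * u y s + 0 * u y s ^ 2) x t =
    D ^ 2 * partial_derive 2 0 u x t).
  { intros x t; unfold partial_derive; rewrite <- Derive_n_scal_l.
    apply Derive_n_ext; intros y; simpl; ring. }
  (* Both [u_tt] and [kappa u_xx] equal [D ^ 2 * H'']. Since [u_xxtt] is [D ^ 2 * H''''] and
     [mu * D ^ 2 = nu * c], the dispersive term supplies the [c] part of [nu * G4]. *)
  assert (Hbalance : forall x t, I (x - D * t) ->
    D ^ 2 * partial_derive 2 0 u x t + nu * u x t * partial_derive 4 0 u x t
    + mu * partial_derive 2 2 u x t
    + 4 * nu * partial_derive 1 0 u x t * partial_derive 3 0 u x t
    + 3 * nu * partial_derive 2 0 u x t ^ 2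
    = partial_derive 0 2 u x t + nu * G4 (x - D * t)).
  { intros x t Hs; rewrite !Hp by (trivial; lia); cbn [Nat.add].
    unfold G4, c, u, travelling_wave; field; exact Hnu. }
  split.
  - intros Hsol s Hs.
    (* Every phase [s] is attained at time 0, so the equation at [t = 0] already gives the whole
       ODE. *)
    assert (Hs' : I (s - D * 0)) by (now replace (s - D * 0) with s by ring).
    specialize (Hsol s 0 Hs'); rewrite Hlin, (Hbalance s 0 Hs') in Hsol.
    replace (s - D * 0) with s in Hsol by ring.
    apply (Rmult_eq_reg_l nu); [lra | exact Hnu].
  - intros E x t Hs.
    rewrite Hlin, (Hbalance x t Hs), (E _ Hs); ring. }
rewrite Hpde; unfold I.
rewrite (fourth_derivative_zero_iff a b (fun s => H s ^ 2 / 2 + c * H s)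
  G1 G2 G3 G4).
- split; intros (C0 & C1 & C2 & C3 & E); exists C0, C1, C2, C3.
  + intros x t; exact (E (x - D * t)).
  + intros s Hs; specialize (E s 0); unfold S, u, travelling_wave in E.
    replace (s - D * 0) with s in E by ring; now apply E.
- intros s Hs; destruct (Hx 0%nat s) as [X0 E0]; [lia | trivial |].
  (* [Derive_n H 0] reduces to [H]; the change makes the hypotheses match the goal syntactically. *)
  change (h 0%nat) with H in *.
  auto_derive; [tauto|].
  rewrite E0; unfold G1; field.
- intros s Hs; unfold G1, G2.
  destruct (Hx 0%nat s) as [X0 E0]; [lia | trivial |].
  destruct (Hx 1%nat s) as [X1 E1]; [lia | trivial |].
  change (h 0%nat) with H in *.
  auto_derive; [tauto|].
  rewrite E0, E1; ring.
- intros s Hs; unfold G2, G3.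
  destruct (Hx 0%nat s) as [X0 E0]; [lia | trivial |].
  destruct (Hx 1%nat s) as [X1 E1]; [lia | trivial |].
  destruct (Hx 2%nat s) as [X2 E2]; [lia | trivial |].
  change (h 0%nat) with H in *.
  auto_derive; [tauto|].
  rewrite E0, E1, E2; ring.
- intros s Hs; unfold G3, G4.
  destruct (Hx 0%nat s) as [X0 E0]; [lia | trivial |].
  destruct (Hx 1%nat s) as [X1 E1]; [lia | trivial |].
  destruct (Hx 2%nat s) as [X2 E2]; [lia | trivial |].
  destruct (Hx 3%nat s) as [X3 E3]; [lia | trivial |].
  change (h 0%nat) with H in *.
  auto_derive; [tauto|].
  rewrite E0, E1, E2, E3; ring.
Qed.
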